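(* Let $k$ be a field and $G$ a (totally) ordered abelian group. Let $s\in k((G))\setminus\{0\}$, let $g\in G$ with $g>0$, and suppose that $r_{s,g}^*=s$. Then $s\in k(G)$ if and only if the rank of the Hankel matrix $\mathcal{H}^{s,g}$ is finite.
   Context: $\mathbb{N}$ includes $0$. $k((G))$ denotes the field of generalised power series: all functions $s\colon G\to k$, written $s=\sum_{g\in G}s_gt^g$, whose support $\mathrm{supp}(s)=\{g\in G\mid s_g\neq 0\}$ is a well-ordered subset of $G$, with pointwise addition and product $sp=\sum_{g}\left(\sum_{h}s_hp_{g-h}\right)t^g$. $k[G]$ is the subring of all $s\in k((G))$ with finite support, and $k(G)$ is the fraction field of $k[G]$ inside $k((G))$. For $s\neq 0$, $v(s)=\min\mathrm{supp}(s)$. A linear recurrence sequence is a partial function $r\colon G\rightharpoonup k$ with well-ordered domain; its associated power series is $r^*=\sum_{g\in\mathrm{dom}(r)}r(g)t^g\in k((G))$. For $s\in k((G))\setminus\{0\}$ and $g>0$, $r_{s,g}$ is the linear recurrence sequence with domain $\{v(s)+ig\mid i\in\mathbb{N}\}$ and $r_{s,g}(v(s)+ig)=s_{v(s)+ig}$. (Thus $r_{s,g}^*=s$ means exactly that $\mathrm{supp}(s)\subseteq\{v(s)+ig\mid i\in\mathbb{N}\}$.) In this case the Hankel matrix associated to $s$ with increment $g$ is $\mathcal{H}^{s,g}=(\mathcal{H}^{s,g}_{ij})_{i,j\in\mathbb{N}}\in k^{\mathbb{N}\times\mathbb{N}}$ with $\mathcal{H}^{s,g}_{ij}=s_{v(s)+(i+j)g}$.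 The rank of such a matrix is the dimension of the $k$-span of its rows in $k^{\mathbb{N}}$. *)

(* Defs.v *)
From HB Require Import structures.
From mathcomp Require Import all_boot all_order all_algebra.
From mathcomp Require Import all_classical.

Set Implicit Arguments.
Unset Strict Implicit.
Unset Printing Implicit Defensive.

Import Order.TTheory GRing.Theory Num.Theory.
Local Open Scope classical_set_scope.
Local Open Scope ring_scope.

(* Totality is a field of the mixin, rather than a join with `orderType`,
   because `realDomainType` is already the only join of `zmodType` and
   `orderType` in the library hierarchy. *)
HB.mixin Record isOrderedGroup G of Num.POrderedZmodule G := {
  og_total : forall x y : G, (x <= y) || (y <= x);
  ogD2r : forall z x y : G, x <= y -> x + z <= y + z
}.

#[short(type="orderedGroupType")]
HB.structure Definition OrderedGroup :=
  { G of isOrderedGroup G & Num.POrderedZmodule G }.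

Section OrderedGroupTheory.
Variable G : orderedGroupType.
Implicit Types (x y z : G) (A B X : set G).

Lemma og_leNgt x y : (x <= y) = ~~ (y < x).
Proof. by rewrite comparable_leNgt ?/Order.comparable ?og_total. Qed.

Lemma og_ltNge x y : (x < y) = ~~ (y <= x).
Proof. by rewrite comparable_ltNge ?/Order.comparable ?og_total. Qed.

Lemma og_leD2r z x y : (x + z <= y + z) = (x <= y).
Proof.
apply/idP/idP => [|/ogD2r//].
by move=> /(ogD2r (- z)); rewrite !addrK.
Qed.

Lemma og_leD2l z x y : (z + x <= z + y) = (x <= y).
Proof. by rewrite ![z + _]addrC og_leD2r. Qed.

Lemma og_ltD2r z x y : (x + z < y + z) = (x < y).
Proof. by rewrite !og_ltNge og_leD2r. Qed.

Lemma og_subr_lt0 x y : (x - y < 0) = (x < y).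
Proof. by rewrite -(og_ltD2r y (x - y)) subrK add0r. Qed.

Lemma og_mulrn_ge0 x i : 0 <= x -> 0 <= x *+ i.
Proof.
move=> x0; elim: i => [|i IH]; first by rewrite mulr0n.
by rewrite mulrS (le_trans IH)// -{1}(add0r (x *+ i)) og_leD2r.
Qed.

Lemma og_lerMn2l x i j : 0 <= x -> (i <= j)%N -> x *+ i <= x *+ j.
Proof.
move=> x0 ij; rewrite -(subnKC ij) mulrnDr -{1}(addr0 (x *+ i)) og_leD2l.
exact: og_mulrn_ge0.
Qed.

Definition well_ordered A :=
  forall X, X `<=` A -> X !=set0 -> exists2 m, X m & forall x, X x -> m <= x.

Lemma well_ordered_sub A B : well_ordered B -> A `<=` B -> well_ordered A.
Proof. by move=> wB AB X XA; apply: wB; apply: subset_trans AB. Qed.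

Lemma well_orderedU A B :
  well_ordered A -> well_ordered B -> well_ordered (A `|` B).
Proof.
move=> wA wB X XAB [x Xx].
have [[a [Xa Aa]]|nA] := pselect (X `&` A !=set0); last first.
  apply: wB; last by exists x.
  by move=> y Xy; case: (XAB _ Xy) => // Ay; case: nA; exists y.
have [[b [Xb Bb]]|nB] := pselect (X `&` B !=set0); last first.
  apply: wA; last by exists x.
  by move=> y Xy; case: (XAB _ Xy) => // By; case: nB; exists y.
have [|m1 [X1 _] h1] := wA (X `&` A) (@subIsetr _ _ _); first by exists a.
have [|m2 [X2 _] h2] := wB (X `&` B) (@subIsetr _ _ _); first by exists b.
have /orP[le|le] := og_total m1 m2.
  exists m1 => // y Xy; case: (XAB _ Xy) => h; first exact: h1.
  by apply: le_trans le _; apply: h2.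
exists m2 => // y Xy; case: (XAB _ Xy) => h; last exact: h2.
by apply: le_trans le _; apply: h1.
Qed.

Lemma well_ordered_ind A (P : G -> Prop) : well_ordered A ->
  (forall a, A a -> (forall b, A b -> b < a -> P b) -> P a) ->
  forall a, A a -> P a.
Proof.
move=> wA H a Aa; apply: contrapT => nPa.
have [|m [Am nPm] mmin] := wA [set b | A b /\ ~ P b] (fun x h => proj1 h).
  by exists a.
apply: nPm; apply: H => // b Ab bm; apply: contrapT => nPb.
by have := mmin b (conj Ab nPb); rewrite og_leNgt bm.
Qed.

Definition addset A B := [set z | exists a b, [/\ A a, B b & z = a + b]].

Lemma well_orderedD A B :
  well_ordered A -> well_ordered B -> well_ordered (addset A B).
Proof.
move=> wA wB.
pose rp X a b := [/\ A a, B b & X (a + b)].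
suff H : forall b0, B b0 -> forall X, X `<=` addset A B ->
    forall a0, rp X a0 b0 -> (forall a b, rp X a b -> a0 <= a) ->
    exists2 m, X m & forall x, X x -> m <= x.
  move=> X XAB [x Xx]; have [a [b [Aa Bb xE]]] := XAB _ Xx.
  have [||a0 [b0 r0] a0min] := wA [set a | exists b, rp X a b].
  - by move=> ? [? []].
  - by exists a, b; split => //; rewrite -xE.
  have [_ Bb0 _] := r0.
  by apply: (H b0 Bb0 X XAB a0 r0) => a' b' r'; apply: a0min; exists b'.
apply: (well_ordered_ind wB) => b0 Bb0 IH X XAB a0 [Aa0 _ Xab] a0min.
pose X' := [set x | X x /\ x < a0 + b0].
have [[x [Xx xlt]]|nX'] := pselect (X' !=set0); last first.
  exists (a0 + b0) => // x Xx; rewrite og_leNgt; apply/negP => xlt.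
  by apply: nX'; exists x.
have X'AB : X' `<=` addset A B by move=> ? [/XAB].
have [a [b [Aa Bb xE]]] := XAB _ Xx.
have [||a1 [b1 r1] a1min] := wA [set a | exists b, rp X' a b].
- by move=> ? [? []].
- by exists a, b; split => //; rewrite -xE.
have [Aa1 Bb1 [X1 lt1]] := r1.
have b10 : b1 < b0.
  rewrite -(og_ltD2r a0) ![_ + a0]addrC; apply: le_lt_trans lt1.
  by rewrite og_leD2r; apply: (a0min _ b1).
have [|m [Xm mlt] mmin] := IH b1 Bb1 b10 X' X'AB a1 r1.
  by move=> a' b' r'; apply: a1min; exists b'.
exists m => // y Xy; have /orP[yge|] := og_total (a0 + b0) y.
  exact: le_trans (ltW mlt) yge.
rewrite le_eqVlt => /orP[/eqP ->|ylt]; first exact: ltW.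
exact: mmin.
Qed.

Lemma well_ordered_fiber A B g : well_ordered A -> well_ordered B ->
  finite_set [set a | A a /\ B (g - a)].
Proof.
move=> wA wB; set F := [set a | _].
have wmax X : X `<=` F -> X !=set0 -> exists2 m, X m & forall x, X x -> x <= m.
  move=> XF [x Xx].
  have [||m Xm mmin] := wB [set b | X (g - b)].
  - by move=> b /= /XF [_]; rewrite opprB addrC subrK.
  - by exists (g - x) => /=; rewrite opprB addrC subrK.
  exists (g - m) => // y Xy; have := mmin (g - y).
  rewrite /= opprB [g + _]addrC subrK => /(_ Xy).
  rewrite -(og_leD2r (y - m) m).
  by rewrite [m + _]addrC subrK [g - y + _]addrA subrK.
apply: contrapT => nF.
have [||m [Fm nm] mmin] :=
    wA [set a | F a /\ ~ finite_set (F `&` [set x | x <= a])].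
- by move=> ? [[]].
- have [||m Fm mmax] := wmax F => //.
    apply: contrapT => F0; apply: nF.
    rewrite (_ : F = set0)//; apply/seteqP; split=> // y Fy.
    by case: F0; exists y.
  exists m; split=> // fm; apply: nF; apply: sub_finite_set fm.
  by move=> x Fx; split=> //; apply: mmax.
have [[x [Fx xm]]|n] := pselect (F `&` [set x | x < m] !=set0); last first.
  apply: nm; apply: sub_finite_set (finite_set1 m) => y [Fy].
  rewrite /= le_eqVlt => /orP[/eqP//|ym]; case: n; by exists y.
have [||p [Fp pm] pmax] := wmax (F `&` [set x | x < m]).
- by move=> ? [].
- by exists x.
have fp : finite_set (F `&` [set x | x <= p]).
  apply: contrapT => np; have := mmin p (conj Fp np).
  by rewrite og_leNgt (pm : p < m).
apply: nm; have : finite_set ((F `&` [set x | x <= p]) `|` [set m]).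
  by rewrite finite_setU.
apply: sub_finite_set => y [Fy]; rewrite /= le_eqVlt => /orP[/eqP|ym].
  by right.
by left; split=> //; apply: pmax.
Qed.

End OrderedGroupTheory.

Record hahn (G : orderedGroupType) (k : fieldType) := Hahn {
  hcoef :> G -> k;
  _ : `[< well_ordered [set g | hcoef g != 0] >]
}.

Section HahnSeries.
Variables (G : orderedGroupType) (k : fieldType).
Implicit Types (s p q : hahn G k) (g h : G).

HB.instance Definition _ := [isSub for @hcoef G k].
HB.instance Definition _ := [Choice of hahn G k by <:].

Definition hsupp s : set G := [set g | s g != 0].

Lemma hsuppE s g : hsupp s g = (s g != 0). Proof. by []. Qed.

Lemma hsupp_wo s : well_ordered (hsupp s).
Proof. by case: s => f fP; move/asboolP: (fP). Qed.
Arguments hsupp_wo : clear implicits.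

Lemma hahnP s p : s =1 p <-> s = p.
Proof. split=> [sp|e]; last by rewrite e. by apply: val_inj; apply/funext. Qed.

Definition mkhahn (f : G -> k) (wf : well_ordered [set g | f g != 0]) :
  hahn G k := Hahn (asboolT wf).

Lemma supp0P s g : ~ hsupp s g -> s g = 0.
Proof. by rewrite /hsupp /= => /negP/negPn/eqP. Qed.

Let cst0_wo : well_ordered [set g : G | (0 : k) != 0].
Proof. by move=> X X0 [x /X0]; rewrite /= eqxx. Qed.
Definition hzero : hahn G k := mkhahn cst0_wo.

Let opp_wo s : well_ordered [set g | - s g != 0].
Proof. by apply: well_ordered_sub (hsupp_wo s) _ => g /=; rewrite oppr_eq0. Qed.
Definition hopp s := mkhahn (@opp_wo s).

Let add_wo s p : well_ordered [set g | s g + p g != 0].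
Proof.
apply: well_ordered_sub (well_orderedU (hsupp_wo s) (hsupp_wo p)) _ => g /= nz.
apply: contrapT => /not_orP[/supp0P s0 /supp0P p0].
by move: nz; rewrite s0 p0 addr0 eqxx.
Qed.
Definition hadd s p := mkhahn (@add_wo s p).

Let haddA : associative hadd.
Proof. by move=> s p q; apply/hahnP => g /=; rewrite addrA. Qed.
Let haddC : commutative hadd.
Proof. by move=> s p; apply/hahnP => g /=; rewrite addrC. Qed.
Let hadd0 : left_id hzero hadd.
Proof. by move=> s; apply/hahnP => g /=; rewrite add0r. Qed.
Let haddN : left_inverse hzero hopp hadd.
Proof. by move=> s; apply/hahnP => g /=; rewrite addNr. Qed.

HB.instance Definition _ :=
  GRing.isZmodule.Build (hahn G k) haddA haddC hadd0 haddN.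

(* All but finitely many terms vanish, by [well_ordered_fiber]. *)
Definition hmul_coef (s p : G -> k) g : k :=
  \sum_(h \in [set: G]) s h * p (g - h).

Lemma hmul_coef_seq (r : seq G) s p g : uniq r ->
    (forall h, hsupp s h -> hsupp p (g - h) -> h \in r) ->
  hmul_coef s p g = \sum_(h <- r) s h * p (g - h).
Proof.
move=> ur rP; rewrite /hmul_coef (fsbigE r)//=.
  by apply: eq_bigl => h; rewrite in_setT.
move=> h _; apply: contraNeq; rewrite mulf_eq0 => /norP[]; exact: rP.
Qed.

Lemma hfiberE (A B : set G) g : well_ordered A -> well_ordered B ->
  {r : seq G | uniq r & forall h, A h -> B (g - h) -> h \in r}.
Proof.
move=> wA wB; have fF := well_ordered_fiber g wA wB.
exists (finmap.enum_fset (fset_set [set a | A a /\ B (g - a)])); first exact: finmap.fset_uniq.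
by move=> h Ah Bh; rewrite in_fset_set// inE.
Qed.

Lemma hmul_coefC s p g : hmul_coef s p g = hmul_coef p s g.
Proof.
have [r ur rP] := hfiberE g (hsupp_wo s) (hsupp_wo p).
rewrite (hmul_coef_seq ur rP) (@hmul_coef_seq [seq g - h | h <- r]).
- rewrite big_map; apply: eq_bigr => h _.
  by rewrite mulrC opprB subrKC.
- by rewrite map_inj_uniq// => x y /addrI/oppr_inj.
- move=> h ph sh; apply/mapP; exists (g - h).
    by apply: rP => //; rewrite opprB subrKC.
  by rewrite opprB subrKC.
Qed.

Lemma hmul_coef_supp s p :
  [set g | hmul_coef s p g != 0] `<=` addset (hsupp s) (hsupp p).
Proof.
move=> g /=; have [r ur rP] := hfiberE g (hsupp_wo s) (hsupp_wo p).
rewrite (hmul_coef_seq ur rP) => nz; apply: contrapT => ng.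
move/eqP: nz; apply; apply: big1 => h _; apply/eqP; apply: contrapT => /negP.
rewrite mulf_eq0 => /norP[sh ph]; apply: ng; exists h, (g - h); split=> //.
by rewrite [h + _]addrC subrK.
Qed.

Let mul_wo s p : well_ordered [set g | hmul_coef s p g != 0].
Proof.
exact: well_ordered_sub (well_orderedD (hsupp_wo s) (hsupp_wo p))
         (@hmul_coef_supp s p).
Qed.
Definition hmul s p := mkhahn (@mul_wo s p).

Lemma hmulE s p g : hmul s p g = hmul_coef s p g.
Proof. by []. Qed.

Let mon_wo (c : k) g : well_ordered [set h | (if h == g then c else 0) != 0].
Proof.
move=> X Xg [x Xx]; have XE y : X y -> y = g.
  by move=> /Xg /=; case: (y =P g) => //; rewrite eqxx.
by exists x => // y Xy; rewrite (XE x Xx) (XE y Xy).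
Qed.
Definition hmon (c : k) g := mkhahn (@mon_wo c g).

Lemma hmonE c g h : hmon c g h = if h == g then c else 0.
Proof. by []. Qed.

Lemma hmul_mon c g s h : hmul (hmon c g) s h = c * s (h - g).
Proof.
rewrite hmulE (@hmul_coef_seq [:: g])//; first by rewrite big_seq1 /= eqxx.
by move=> i; rewrite /hsupp /= inE; case: (i == g); rewrite ?eqxx.
Qed.

Let hmulC : commutative hmul.
Proof. by move=> s p; apply/hahnP => g; exact: hmul_coefC. Qed.

Let hmul1 : left_id (hmon 1 0) hmul.
Proof. by move=> s; apply/hahnP => g; rewrite hmul_mon mul1r subr0. Qed.

Let hmulDl : left_distributive hmul hadd.
Proof.
move=> s p q; apply/hahnP => g.
have wU := well_orderedU (hsupp_wo s) (hsupp_wo p).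
have [r ur rP] := hfiberE g (well_orderedU wU (hsupp_wo (hadd s p))) (hsupp_wo q).
rewrite hmulE [RHS](_ : _ = hmul_coef s q g + hmul_coef p q g)//.
rewrite !(@hmul_coef_seq r)//.
- by rewrite -big_split /=; apply: eq_bigr => h _; rewrite mulrDl.
- by move=> h *; apply: rP => //; left; right.
- by move=> h *; apply: rP => //; left; left.
- by move=> h *; apply: rP => //; right.
Qed.

Let hmulA : associative hmul.
Proof.
move=> s p q; apply/hahnP => g.
have wpq := well_orderedD (hsupp_wo p) (hsupp_wo q).
have wps := well_orderedD (hsupp_wo p) (hsupp_wo s).
have [rs us rsP] := hfiberE g (hsupp_wo s) wpq.
have [rq uq rqP] := hfiberE g (hsupp_wo q) wps.
transitivity (\sum_(i <- rs) \sum_(j <- rq) s i * (q j * p (g - i - j))).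
  rewrite hmulE (hmul_coef_seq us); last first.
    by move=> h sh /hmul_coef_supp; exact: rsP.
  apply: eq_bigr => i _; have [->|si] := eqVneq (s i) 0.
    by rewrite mul0r big1// => j _; rewrite mul0r.
  rewrite hmulC hmulE (@hmul_coef_seq rq) ?mulr_sumr// => j qj pj.
  apply: rqP => //; exists (g - i - j), i; split=> //.
  by rewrite addrAC subrK.
rewrite exchange_big hmulC hmulE (hmul_coef_seq uq) /=; last first.
  by move=> h qh; rewrite hmulC => /hmul_coef_supp; exact: rqP.
apply: eq_bigr => j _; have [->|qj] := eqVneq (q j) 0.
  by rewrite mul0r big1// => i _; rewrite mul0r mulr0.
rewrite (@hmul_coef_seq rs)// ?mulr_sumr.
  by apply: eq_bigr => i _; rewrite mulrCA [g - i - j]addrAC.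
move=> i si pi; apply: rsP => //; exists (g - j - i), j; split=> //.
by rewrite addrAC subrK addrC.
Qed.

Let hone_neq0 : hmon 1 0 != hzero.
Proof.
apply/eqP => /hahnP/(_ 0); rewrite hmonE eqxx /= => /eqP.
by rewrite oner_eq0.
Qed.

HB.instance Definition _ := GRing.Zmodule_isComNzRing.Build (hahn G k)
  hmulA hmulC hmul1 hmulDl hone_neq0.

Lemma hcoef0 g : (0 : hahn G k) g = 0. Proof. by []. Qed.
Lemma hcoefD s p g : (s + p) g = s g + p g. Proof. by []. Qed.
Lemma hcoefN s g : (- s) g = - s g. Proof. by []. Qed.
Lemma hcoefM s p g : (s * p) g = \sum_(h \in [set: G]) s h * p (g - h).
Proof. by []. Qed.
Lemma hcoef1 g : (1 : hahn G k) g = if g == 0 then 1 else 0. Proof. by []. Qed.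
Lemma hcoef_monM c g s h : (hmon c g * s) h = c * s (h - g).
Proof. exact: hmul_mon. Qed.

Lemma hsupp_min s : s != 0 ->
  exists m, hsupp s m /\ forall h, hsupp s h -> m <= h.
Proof.
move=> /eqP s0; have [||m sm mmin] := hsupp_wo s (hsupp s) => //.
  apply: contrapT => n; apply: s0; apply/hahnP => g.
  by rewrite hcoef0; apply: supp0P => sg; apply: n; exists g.
by exists m.
Qed.

(* If [y] and [z] agree on all exponents up to [g], so do [s * y], [s * z]
   when [s] has no negative exponents. *)
Lemma hmul_local s (y z : hahn G k) g : (forall h, h < 0 -> s h = 0) ->
  (forall h, h <= g -> y h = z h) -> (s * y) g = (s * z) g.
Proof.
move=> s_ge0 yz; rewrite !hcoefM; apply: eq_fsbigr => h _.
have [h0|/negPf] := boolP (h < 0); first by rewrite s_ge0 ?mul0r.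
move=> /negbT; rewrite -og_leNgt => h0; rewrite yz//.
by rewrite -(og_leD2r h (g - h)) subrK -{1}(addr0 g) og_leD2l.
Qed.

(* Existence of the inverse, by Zorn's lemma on the partial inverses ordered
   by end-extension. *)
Lemma hinv_unit s : s 0 != 0 -> (forall h, h < 0 -> s h = 0) ->
  exists y : hahn G k, s * y = 1.
Proof.
move=> s0 s_ge0.
pose good (y : hahn G k) :=
  forall c, hsupp y c -> forall d, d <= c -> (s * y) d = (1 : hahn G k) d.
pose T := {y : hahn G k | good y}.
pose R (y z : T) :=
  `[< forall c, hsupp (sval y) c -> forall d, d <= c -> sval z d = sval y d >].
have RP y z : R y z -> forall c, hsupp (sval y) c ->
    forall d, d <= c -> sval z d = sval y d by move/asboolP.
have Rsub y z c : R y z -> hsupp (sval y) c -> hsupp (sval z) c.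
  by move=> /RP h yc; rewrite hsuppE (h c).
have [||||[y gy] ymax] := @Zorn T R.
- by move=> y; apply/asboolP.
- move=> x y z xy yz; apply/asboolP => c xc d dc.
  by rewrite (RP _ _ yz c)// ?(RP _ _ xy c)//; exact: Rsub xy xc.
- move=> [y gy] [z gz] yz zy; apply: eq_exist; apply/hahnP => d.
  have [yd|/supp0P yd] := pselect (hsupp y d).
    by rewrite -(RP _ _ yz d yd d).
  have [zd|/supp0P zd] := pselect (hsupp z d).
    by rewrite -(RP _ _ zy d zd d).
  by rewrite yd zd.
- move=> A totA.
  pose P d (y : T) := A y /\ hsupp (sval y) d.
  pose f d := if pselect (exists y, P d y) is left e
              then sval (projT1 (cid e)) d else 0.
  have fE y : A y -> forall c, hsupp (sval y) c ->
      forall d, d <= c -> f d = sval y d.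
    move=> Ay c yc d dc; rewrite /f; case: pselect => [e|ne]; last first.
      apply/esym/supp0P => yd; apply: ne; by exists y.
    case: (cid e) => z [/= Az zd]; have [zy|yz] := totA _ _ Az Ay.
      by rewrite (RP _ _ zy d).
    by rewrite (RP _ _ yz c).
  have fex d : f d != 0 -> exists2 y, A y & hsupp (sval y) d.
    rewrite /f; case: pselect => [e _|]; last by rewrite eqxx.
    by case: e => y []; exists y.
  have wf : well_ordered [set d | f d != 0].
    move=> X Xf [x Xx]; have [y Ay yx] := fex _ (Xf _ Xx).
    have [||m [Xm mx] mmin] := hsupp_wo (sval y) (X `&` [set d | d <= x]).
    - by move=> d [/Xf /= fd dx]; rewrite hsuppE -(fE y Ay x).
    - by exists x; split => //=.
    exists m => // d Xd; have /orP[dx|xd] := og_total d x; first exact: mmin.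
    exact: le_trans mx xd.
  have gf : good (mkhahn wf).
    move=> c fc d dc; have [y Ay yc] := fex _ fc.
    rewrite -(proj2_sig y c yc d dc); apply: hmul_local => // h hd.
    by apply: (fE y Ay c yc); exact: le_trans hd dc.
  exists (exist _ _ gf) => y Ay; apply/asboolP => c yc d dc /=.
  exact: (fE y Ay c).
exists y; apply: contrapT => sy1.
have [|c [ec cmin]] := @hsupp_min (1 - s * y).
  by rewrite subr_eq0; apply/eqP => /esym.
have lt_c d : d < c -> (s * y) d = (1 : hahn G k) d.
  move=> dc; apply/eqP; rewrite eq_sym -subr_eq0; apply: contrapT => /negP nz.
  by have := cmin d nz; rewrite og_leNgt dc.
have supp_lt d : hsupp y d -> d < c.
  move=> yd; rewrite og_ltNge; apply/negP => cd.
  by move: ec; rewrite hsuppE hcoefD hcoefN (gy d yd)// subrr eqxx.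
pose e := (1 - s * y : hahn G k) c.
pose z := y + hmon (e / s 0) c.
have zlt d : d < c -> z d = y d.
  by move=> dc; rewrite hcoefD hmonE lt_eqF// addr0.
have suppz d : hsupp z d -> d <= c.
  rewrite hsuppE hcoefD hmonE; case: (d =P c) => [->//|_].
  by rewrite addr0 => /supp_lt/ltW.
have gz : good z.
  move=> d /suppz dc b bd; have := le_trans bd dc.
  rewrite mulrDr hcoefD [s * hmon _ _]mulrC hcoef_monM le_eqVlt.
  case/orP => [/eqP ->|bc].
    by rewrite subrr mulfVK// /e hcoefD hcoefN addrC subrK.
  by rewrite lt_c// (s_ge0 (b - c)) ?mulr0 ?addr0// og_subr_lt0.
have yz : R (exist _ y gy) (exist _ z gz).
  apply/asboolP => d /= yd b bd; apply: zlt.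
  exact: le_lt_trans bd (supp_lt _ yd).
have /(congr1 sval) /= /eqP := ymax _ yz; rewrite /z -subr_eq0 [y + _]addrC addrK => /eqP/hahnP/(_ c).
rewrite hmonE eqxx hcoef0 => /eqP; rewrite mulf_eq0 invr_eq0.
by rewrite (negPf s0) orbF; apply/negP.
Qed.

Lemma hinv_exists s : s != 0 -> exists y : hahn G k, y * s = 1.
Proof.
move=> /hsupp_min[m [sm mmin]].
have [||y ey] := @hinv_unit (hmon 1 (- m) * s).
- by rewrite hcoef_monM opprK add0r mul1r.
- move=> h h0; rewrite hcoef_monM opprK mul1r; apply: supp0P => /mmin.
  by rewrite -{1}(add0r m) og_leD2r og_leNgt h0.
by exists (y * hmon 1 (- m)); rewrite -mulrA mulrC.
Qed.

Definition hinv s : hahn G k :=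
  if pselect (exists y : hahn G k, y * s = 1) is left e then projT1 (cid e) else 0.

Let hmulV s : s != 0 -> hinv s * s = 1.
Proof.
move=> /hinv_exists ex; rewrite /hinv; case: pselect => // e.
by case: (cid e).
Qed.

Let hinv0 : hinv 0 = 0.
Proof.
rewrite /hinv; case: pselect => // e; case: (cid e) => /= y.
by rewrite mulr0 => /eqP; rewrite eq_sym oner_eq0.
Qed.

HB.instance Definition _ :=
  GRing.ComNzRing_isField.Build (hahn G k) hmulV hinv0.

(* The group ring k[G], as a subset of k((G)). *)
Definition hpoly : set (hahn G k) := [set p | finite_set (hsupp p)].

(* The field k(G), as a subset of k((G)). *)
Definition hrat : set (hahn G k) :=
  [set s | exists p q, [/\ hpoly p, hpoly q, q != 0 & s = p / q]].

(* The valuation min (supp s); the value at s = 0 is irrelevant. *)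
Definition hval s : G :=
  xget 0 [set m | hsupp s m /\ forall h, hsupp s h -> m <= h].

Lemma hvalP s : s != 0 ->
  hsupp s (hval s) /\ forall h, hsupp s h -> hval s <= h.
Proof. by move=> /hsupp_min[m hm]; rewrite /hval; case: xgetP => [? -> //|/(_ m)]. Qed.

End HahnSeries.

Arguments hsupp_wo {G k} s.

Section LinearRecurrenceSequences.
Variables (G : orderedGroupType) (k : fieldType).

(* Partial functions from G to k are maps to `option k`. *)
Record lrs := LRS {
  lrs_fun :> G -> option k;
  lrs_dom_wo : well_ordered [set h | lrs_fun h]
}.

Arguments lrs_dom_wo : clear implicits.

Let series_wo (r : lrs) : well_ordered [set h | odflt 0 (r h) != 0].
Proof.
apply: well_ordered_sub (lrs_dom_wo r) _ => h /=.
by case: (r h) => //=; rewrite eqxx.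
Qed.

Definition lrs_series (r : lrs) : hahn G k := mkhahn (@series_wo r).

Definition arith_prog (v g : G) : set G := [set v + g *+ i | i in [set: nat]].

Lemma arith_prog_wo v g : 0 < g -> well_ordered (arith_prog v g).
Proof.
move=> g0 X Xv [x Xx]; have exn : exists i, `[< X (v + g *+ i) >].
  by have [i _ iE] := Xv _ Xx; exists i; apply/asboolP; rewrite iE.
case: (ex_minnP exn) => i /asboolP Xi imin; exists (v + g *+ i) => // y Xy.
have [j _ jE] := Xv _ Xy; rewrite -jE og_leD2l.
by apply: og_lerMn2l (ltW g0) _; apply: imin; apply/asboolP; rewrite jE.
Qed.

Variables (s : hahn G k) (g : G).

Definition lrs_prog_fun h : option k :=
  if h \in arith_prog (hval s) g then Some (s h) else None.

Let lrs_prog_wo : 0 < g -> well_ordered [set h | lrs_prog_fun h].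
Proof.
move=> g0; apply: well_ordered_sub (arith_prog_wo (v := hval s) g0) _ => h /=.
by rewrite /lrs_prog_fun; case: ifP => // /set_mem.
Qed.

(* The sequence r_{s,g}. *)
Definition lrs_prog (g0 : 0 < g) : lrs := LRS (lrs_prog_wo g0).

Definition hankel (i j : nat) : k := s (hval s + g *+ (i + j)).

End LinearRecurrenceSequences.

Arguments lrs_dom_wo {G k} _.

Section Rank.
Variables (k : fieldType) (V : lmodType k).

Definition lin_span (A : set V) : set V :=
  [set u | exists n (c : 'I_n -> k) (w : 'I_n -> V),
     (forall i, A (w i)) /\ u = \sum_(i < n) c i *: w i].

Definition lin_free n (w : 'I_n -> V) :=
  forall c : 'I_n -> k, \sum_(i < n) c i *: w i = 0 -> forall i, c i = 0.

Definition has_dim (U : set V) (n : nat) :=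
  exists w : 'I_n -> V, lin_free w /\ U = lin_span (range w).

End Rank.

(* The cast to k^o gives the rows the pointwise k-module structure. *)
Definition has_rank (k : fieldType) (H : nat -> nat -> k) (n : nat) :=
  has_dim (lin_span (range (H : nat -> nat -> k^o))) n.

Definition finite_rank (k : fieldType) (H : nat -> nat -> k) :=
  exists n, has_rank H n.

(* Main.v *)
Require Import Defs.
From mathcomp Require Import all_boot all_order all_algebra.
From mathcomp Require Import all_classical.

Import Order.TTheory GRing.Theory Num.Theory.
Local Open Scope classical_set_scope.
Local Open Scope ring_scope.

(* Write [a_i] for the coefficient of [s] at [v(s) + i g].  If [q * s] has finite
   support, with [q <> 0] of finite support and least exponent [h0], then the
   coefficients of [q * s] along [h0 + v(s) + N g] only involve the [q_(h0 + i g)],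
   and they vanish far out; since [q_h0 <> 0] this expresses each late row of the
   Hankel matrix through earlier rows.  Conversely, a linear dependence
   [sum_(i <= n) c_i row_i = 0] says that [sum_(i <= n) c_i t^((n - i) g)]
   multiplies [s] into [k[G]]. *)

(** * Linear algebra: finite spans, dimension and dependence *)

Section LinearSpan.
Context {k : fieldType} {V : lmodType k}.
Implicit Types (A : set V) (u : V).

Lemma lin_comb_comb {m n : nat} (d : 'I_m -> k) (a : 'I_m -> V) (w : 'I_n -> V) :
  (forall j, exists c : 'I_n -> k, a j = \sum_(i < n) c i *: w i) ->
  exists c : 'I_n -> k, \sum_(j < m) d j *: a j = \sum_(i < n) c i *: w i.
Proof.
move=> /choice[C aE]; exists (fun i => \sum_(j < m) d j * C j i).
under eq_bigr => j _ do rewrite aE scaler_sumr.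
rewrite exchange_big; apply: eq_bigr => i _.
by rewrite scaler_suml; apply: eq_bigr => j _; rewrite scalerA.
Qed.

Lemma lin_comb_gen {n : nat} (w : 'I_n -> V) i :
  exists c : 'I_n -> k, w i = \sum_(j < n) c j *: w j.
Proof.
exists (fun j => (j == i)%:R); rewrite (bigD1 i)//= eqxx scale1r big1 ?addr0//.
by move=> j /negPf ->; rewrite scale0r.
Qed.

(** [lin_span] allows sums of any length with repeated vectors; over a finite family these collect
    into one coefficient per index. *)
Lemma lin_span_rangeP {n : nat} (w : 'I_n -> V) u :
  lin_span (range w) u <-> exists c : 'I_n -> k, u = \sum_(i < n) c i *: w i.
Proof.
split=> [[m [d [a [aw ->]]]]|[c ->]]; last first.
  by exists n, c, w; split=> // i; exists i.
by apply: lin_comb_comb => j; have [i _ <-] := aw j; exact: lin_comb_gen.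
Qed.

Lemma lin_span_gen A : A `<=` lin_span A.
Proof.
move=> u Au; exists 1%N, (fun=> 1), (fun=> u); split=> //.
by rewrite big_ord1 scale1r.
Qed.

Lemma lin_span_sub_range {n : nat} A (w : 'I_n -> V) :
  A `<=` lin_span (range w) -> lin_span A `<=` lin_span (range w).
Proof.
move=> Aw _ [m [d [a [aA ->]]]]; apply/lin_span_rangeP; apply: lin_comb_comb.
by move=> j; apply/lin_span_rangeP/Aw.
Qed.

Lemma lin_spanS A (B : set V) : A `<=` B -> lin_span A `<=` lin_span B.
Proof.
by move=> AB _ [m [d [a [aA ->]]]]; exists m, d, a; split=> // i; exact: AB.
Qed.

Lemma has_dim_span_range {n : nat} (w : 'I_n -> V) :
  exists m, has_dim (lin_span (range w)) m.
Proof.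
elim: n w => [|n IH] w; first by exists 0%N, w; split=> // c _ [].
have [fw|] := pselect (lin_free w); first by exists n.+1, w.
move=> /existsNP[c /not_implyP[c0 /existsNP[i /eqP ci]]].
have [m dm] := IH (w \o lift i); exists m.
rewrite (_ : lin_span _ = lin_span (range (w \o lift i)))//.
apply/seteqP; split; last by apply: lin_spanS => _ [j _ <-]; exists (lift i j).
apply: lin_span_sub_range => _ [j _ <-].
case: (unliftP i j) => [j' ->|->]; first by apply: lin_span_gen; exists j'.
apply/lin_span_rangeP; exists (fun j' => - (c i)^-1 * c (lift i j')).
move: c0; rewrite (bigD1_ord i)//= => /eqP; rewrite addr_eq0 => /eqP c0.
rewrite -[LHS](scalerK ci) c0 scalerN -scaleNr scaler_sumr.
by apply: eq_bigr => j' _; rewrite scalerA.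
Qed.

Lemma lin_dep_of_span {n : nat} (w : 'I_n -> V) (a : 'I_n.+1 -> V) :
  (forall j, lin_span (range w) (a j)) ->
  exists c : 'I_n.+1 -> k, (exists i, c i != 0) /\ \sum_(j < n.+1) c j *: a j = 0.
Proof.
move=> aw; have [C aE] := choice (fun j => (lin_span_rangeP w (a j)).1 (aw j)).
pose M : 'M[k]_(n.+1, n) := \matrix_(j, i) C j i.
(* [M] has [n.+1] rows and rank at most [n], so its left kernel is nonzero. *)
have /rowV0Pn[v /sub_kermxP vM v0] : kermx M != 0.
  by rewrite kermx_eq0 /row_free neq_ltn ltnS rank_leq_col.
exists (v 0); split.
  apply/existsP; apply: contraNT v0 => /existsPn v0; apply/eqP/rowP => i.
  by rewrite mxE; apply/eqP; rewrite -[_ == _]negbK.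
under eq_bigr => j _ do rewrite aE scaler_sumr.
rewrite exchange_big big1// => i _.
under eq_bigr => j _ do rewrite scalerA.
rewrite -scaler_suml; suff -> : \sum_(j < n.+1) v 0 j * C j i = 0 by rewrite scale0r.
have /rowP/(_ i) := vM; rewrite !mxE => {2}<-.
by apply: eq_bigr => j _; rewrite mxE.
Qed.

(** Strong induction on the index: the recurrence pushes every late vector down to the first [N]. *)
Lemma lin_recurrence_span (R : nat -> V) (N : nat) :
  (forall m, (N <= m)%N -> exists e : 'I_m -> k, R m = \sum_(i < m) e i *: R i) ->
  range R `<=` lin_span (range (fun i : 'I_N => R i)).
Proof.
move=> Rrec _ [m _ <-]; elim/ltn_ind: m => m IH.
have [mN|Nm] := ltnP m N; first by apply: lin_span_gen; exists (Ordinal mN).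
have [e ->] := Rrec m Nm; apply/lin_span_rangeP; apply: lin_comb_comb => j.
by apply/lin_span_rangeP/IH.
Qed.

End LinearSpan.

(** * Multiples of a positive element *)

Section Progressions.
Context {G : orderedGroupType}.
Context {g : G}.
Hypothesis g_gt0 : 0 < g.

Lemma og_ltMn2l {i j : nat} : (i < j)%N -> g *+ i < g *+ j.
Proof.
move=> ij; apply: (@lt_le_trans _ _ (g *+ i.+1)); last exact: og_lerMn2l (ltW g_gt0) ij.
by rewrite mulrS -{1}(add0r (g *+ i)) og_ltD2r.
Qed.

Lemma og_leMn2lE (i j : nat) : (g *+ i <= g *+ j) = (i <= j)%N.
Proof.
apply/idP/idP => [|/(og_lerMn2l (ltW g_gt0))//].
by apply: contraTT; rewrite -ltnNge -og_ltNge => /og_ltMn2l.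
Qed.

Lemma og_mulrn_inj : injective (GRing.natmul g).
Proof.
move=> i j ij; apply/eqP.
by rewrite eqn_leq -!og_leMn2lE ij lexx.
Qed.

(** The progression is injective, so each element of [F] is met at most once. *)
Lemma arith_prog_eventually_notin {F : set G} (x : G) : finite_set F ->
  exists N, forall i, (N <= i)%N -> ~ F (x + g *+ i).
Proof.
move=> /finite_seqP[r ->]; elim: r => [|y r [N IH]].
  by exists 0%N => i _.
have [[j xj]|nj] := pselect (exists j, x + g *+ j = y).
  exists (maxn N j.+1) => i; rewrite geq_max => /andP[Ni ji] /=.
  rewrite inE => /orP[/eqP|/(IH _ Ni)//]; rewrite -xj => /addrI/og_mulrn_inj ij.
  by move: ji; rewrite ij ltnn.
exists N => i Ni /=; rewrite inE => /orP[/eqP xi|/(IH _ Ni)//].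
by apply: nj; exists i.
Qed.

End Progressions.

(** * Rationality versus finite Hankel rank *)

Section Hankel.
Context {G : orderedGroupType} {k : fieldType}.
Variables (s : hahn G k) (g : G).
Hypothesis g_gt0 : 0 < g.
Hypothesis s_prog : hsupp s `<=` arith_prog (hval s) g.

Let a (i : nat) : k := s (hval s + g *+ i).

(** Only exponents [hval s + g *+ i] of [s] contribute; the complementary exponent is at least [h0]
    only if [i <= M], so [M - i] is never truncated. *)
Lemma hcoefM_prog (q : hahn G k) (h0 : G) (M : nat) :
  (forall h, hsupp q h -> h0 <= h) ->
  (q * s) (h0 + hval s + g *+ M) = \sum_(i < M.+1) q (h0 + g *+ (M - i)) * a i.
Proof.
move=> q_ge; rewrite mulrC -[LHS]/(hmul_coef s q _).
rewrite (@hmul_coef_seq _ _ [seq hval s + g *+ i | i <- iota 0 M.+1]).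
- rewrite big_map -{1}(subn0 M.+1) -/(index_iota 0 M.+1) big_mkord.
  apply: eq_bigr => i _; rewrite mulrC; congr (q _ * _).
  by rewrite opprD addrACA addrK mulrnBr // leq_ord.
- by rewrite map_inj_uniq ?iota_uniq// => i j /addrI/(og_mulrn_inj g_gt0).
- move=> h /s_prog[i _ <-] /q_ge hq; apply/mapP; exists i => //.
  rewrite mem_iota add0n ltnS leq0n -(og_leMn2lE g_gt0) -(og_leD2l h0).
  move: hq; rewrite opprD addrACA addrK -(og_leD2r (g *+ i)).
  by rewrite -addrA subrK; apply.
Qed.

Lemma hrat_hankel_finite_rank : hrat s -> finite_rank (hankel s g).
Proof.
move=> [p [q [pfin qfin q0 sE]]].
have [q_h0 q_ge] := hvalP q0; set h0 := hval q in q_h0 q_ge.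
have qsE : q * s = p by rewrite sE mulrCA divff ?mulr1.
have [N1 qN] := arith_prog_eventually_notin g_gt0 h0 qfin.
have [N2 pN] := arith_prog_eventually_notin g_gt0 (h0 + hval s) pfin.
have rec m : (maxn N1 N2 <= m)%N -> exists e : 'I_m -> k,
    (hankel s g m : nat -> k^o) = \sum_(i < m) e i *: (hankel s g i : nat -> k^o).
  rewrite geq_max => /andP[N1m N2m].
  exists (fun i => - (q h0)^-1 * q (h0 + g *+ (m - i))).
  apply/funext => j; rewrite fct_sumE.
  (* This is the coefficient of [p] at step [m + j], which vanishes since [m >= N2]. The terms of
     index below [j] drop out because they involve [q] at steps beyond [m >= N1]; the others are
     shifted by [j]. *)
  have : \sum_(i < m.+1) q (h0 + g *+ (m - i)) * a (i + j) = 0.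
    transitivity ((q * s) (h0 + hval s + g *+ (m + j))); last first.
      by rewrite qsE; apply/supp0P/pN; rewrite (leq_trans N2m)// leq_addr.
    rewrite hcoefM_prog//.
    rewrite -(big_mkord xpredT (fun i => q (h0 + g *+ (m + j - i)) * a i)).
    rewrite (@big_cat_nat _ _ _ j)//=; last by rewrite ltnW// ltnS leq_addl.
    rewrite [X in _ = X + _]big_nat_cond [X in _ = X + _]big1 ?add0r => [|i];
      last first.
      move=> /andP[/andP[_ ij] _]; rewrite (supp0P (qN _ _)) ?mul0r//.
      by rewrite (leq_trans N1m)// -addnBA ?leq_addr// ltnW.
    rewrite -[X in \sum_(X <= i < _) _]add0n big_addn -addSn addnK big_mkord.
    by apply: eq_bigr => i _; rewrite subnDr.
  (* The last term is [q h0 * a (m + j)]; as [q h0] is nonzero, it can be solved for the entry of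
     row [m]. *)
  rewrite big_ord_recr /= subnn mulr0n addr0 => /eqP.
  rewrite addrC addr_eq0 => /eqP h0m.
  rewrite -[LHS](mulKf q_h0) [q h0 * _]h0m mulrN -mulNr mulr_sumr.
  by apply: eq_bigr => i _; rewrite mulrA.
pose w (i : 'I_(maxn N1 N2)) := hankel s g i : nat -> k^o.
have [n dn] := has_dim_span_range w.
exists n; rewrite /has_rank (_ : lin_span _ = lin_span (range w))//.
apply/seteqP; split; last by apply: lin_spanS => _ [i _ <-]; exists i.
exact/lin_span_sub_range/lin_recurrence_span.
Qed.

Lemma hankel_finite_rank_hrat : finite_rank (hankel s g) -> hrat s.
Proof.
move=> [n [w [_ wE]]].
(* The first [n.+1] rows lie in a span of [n] vectors, hence are dependent. *)
have [|c [[i0 ci0] c0]] := @lin_dep_of_span k (nat -> k^o) n w (fun i => hankel s g i).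
  by move=> j; rewrite -wE; apply: lin_span_gen; exists j.
have rel j : \sum_(i < n.+1) c i * a (i + j) = 0.
  by have := congr1 (fun f => f j) c0; rewrite fct_sumE.
(* The reversed exponents turn the sums in [rel] into convolutions, that is, into coefficients of
   [q * s]. *)
pose q : hahn G k := \sum_(i < n.+1) hmon (c i) (g *+ (n - i)).
have coefS (F : 'I_n.+1 -> hahn G k) h : (\sum_i F i) h = \sum_i F i h.
  by apply: (big_morph (fun f : hahn G k => f h)) => //; exact: hcoefD.
have qE h : q h = \sum_(i < n.+1) if h == g *+ (n - i) then c i else 0.
  by rewrite coefS.
have q0 : q != 0.
  apply: contra_neq ci0 => q0; have := qE (g *+ (n - i0)).
  rewrite q0 hcoef0 (bigD1 i0)//= eqxx big1 ?addr0// => i ii0.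
  case: eqP => // /(og_mulrn_inj g_gt0)/(congr1 (subn n)).
  by rewrite !subKn ?leq_ord// => /val_inj ii; rewrite ii eqxx in ii0.
have supp_fin (p : hahn G k) x N :
    (forall h, hsupp p h -> exists2 i, (i < N)%N & h = x + g *+ i) -> hpoly p.
  move=> pN; apply: (@sub_finite_set _ _ ((fun i => x + g *+ i) @` `I_N)).
    by move=> h /pN[i iN ->]; exists i.
  exact/finite_image/finite_II.
exists (q * s), q; split=> //; last by rewrite mulrC mulKf.
(* The bound is [n] because at step [M >= n] the coefficient of [q * s] is the sum in [rel] at
   [M - n]. *)
- apply: (supp_fin _ (hval s) n) => h; rewrite hsuppE => qs.
  have qsE : (q * s) h = \sum_(i < n.+1) c i * s (h - g *+ (n - i)).
    by rewrite mulr_suml coefS; apply: eq_bigr => i _; rewrite hcoef_monM.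
  have [i si] : exists i : 'I_n.+1, s (h - g *+ (n - i)) != 0.
    apply/existsP; apply: contraNT qs => /existsPn s0; rewrite qsE big1// => i _.
    by move: (s0 i); rewrite negbK => /eqP ->; rewrite mulr0.
  have [j _ /eqP] := s_prog _ si; rewrite eq_sym subr_eq -addrA -mulrnDr => /eqP hE.
  exists (j + (n - i))%N => //; rewrite ltnNge; apply: contraNN qs => nM.
  rewrite qsE hE -[X in _ == X](rel (j + (n - i) - n)%N).
  apply/eqP; apply: eq_bigr => l _; congr (_ * s _).
  rewrite -addrA -mulrnBr; last by rewrite (leq_trans (leq_subr _ _)).
  by congr (_ + _ *+ _); rewrite subnBA ?leq_ord// (addnBA l nM) [(l + _)%N]addnC.
- apply: (supp_fin _ 0 n.+1) => h; rewrite hsuppE qE => qh.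
  have [i hi] : exists i : 'I_n.+1, h == g *+ (n - i).
    apply/existsP; apply: contraNT qh => /existsPn h0; rewrite big1// => i _.
    by rewrite (negPf (h0 i)).
  by exists (n - i)%N; rewrite ?add0r ?ltnS ?leq_subr//; apply/eqP.
Qed.

End Hankel.

Theorem theorem5p5 (k : fieldType) (G : orderedGroupType)
    (s : hahn G k) (s_neq0 : s != 0) (g : G) (g_gt0 : 0 < g)
    (rs : lrs_series (lrs_prog s g_gt0) = s) :
  hrat s <-> finite_rank (hankel s g).
Proof.
(* Off the progression [lrs_prog_fun] is [None], which the associated series reads as 0. *)
have s_prog : hsupp s `<=` arith_prog (hval s) g.
  move=> h; rewrite hsuppE -{1}rs /= /lrs_prog_fun.
  by case: ifP => [/set_mem//|_] /=; rewrite eqxx.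
split; [exact: hrat_hankel_finite_rank | exact: hankel_finite_rank_hrat].
Qed.
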